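(* Let $\alpha,\beta>-1$ and let $w_{JS}(x)=x^{\alpha}(1-x)^{\beta}w_0(x)$ on $[0,1]$ be a shifted Jacobi-type weight as in the context, $v_{JS}(x):=-\ln w_{JS}(x)$. Let $t\in[0,1]$, $\gamma>0$, let $A,B$ be real constants, let $w_{JS}$ be independent of $t$, and put $$w(x;t)=w_{JS}(x)|x-t|^{\gamma}\bigl(A+B\theta(x-t)\bigr),\qquad x\in[0,1],$$ where $\theta(x)=1$ for $x>0$ and $\theta(x)=0$ otherwise. Let $P_n(x)=P_n(x;t)$ be the monic orthogonal polynomials associated with $w(x;t)$ on $[0,1]$, with $h_n$, $\mathbf p(n)$, $\beta_n$ as in the context. Then for all $n\ge0$ $$P_n'(z)=-B_n(z)P_n(z)+\beta_nA_n(z)P_{n-1}(z),$$ $$P_{n-1}'(z)=\bigl(B_n(z)+v_{JS}'(z)\bigr)P_{n-1}(z)-A_{n-1}(z)P_n(z),$$ where $A_{-1}(z)=B_0(z):=0$, $$\begin{aligned}A_n(z)=\frac{1}{z(1-z)}\Biggl[&\frac1{h_n}\int_0^1\frac{(z-z^2)v_{JS}'(z)-(x-x^2)v_{JS}'(x)}{z-x}P_n^2(x;t)w(x;t)\,dx+2n+1\\&+\frac{\gamma}{h_n}\int_0^1\frac{x-x^2}{(z-x)(x-t)}P_n^2(x;t)w(x;t)\,dx\Biggr],\quad n\ge0,\end{aligned}$$ $$\begin{aligned}B_n(z)=\frac{1}{z(1-z)}\Biggl[&\frac1{h_{n-1}}\int_0^1\frac{(z-z^2)v_{JS}'(z)-(x-x^2)v_{JS}'(x)}{z-x}P_{n-1}(x;t)P_n(x;t)w(x;t)\,dx+n(z-1)-\mathbf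 p(n)\\&+\frac{\gamma}{h_{n-1}}\int_0^1\frac{x-x^2}{(z-x)(x-t)}P_{n-1}(x;t)P_n(x;t)w(x;t)\,dx\Biggr],\quad n\ge1.\end{aligned}$$
   Context: Weight: $w_0$ is a positive continuously differentiable function on the interior $(0,1)$, bounded near the endpoints $0,1$; all moments $\int_0^1x^jw_{JS}(x)\,dx$ are finite. The constants $A,B$ are such that $w(\cdot;t)\ge0$ on $[0,1]$ and $w(\cdot;t)$ is positive on a set of positive measure. (The constants $A,B$ are unrelated to the functions $A_n(z),B_n(z)$.) Polynomials: $P_0:=1$, $P_{-1}:=0$, and $P_j(x)=x^j+\mathbf p(j)x^{j-1}+\cdots$ for $j\ge1$ is the monic polynomial of degree $j$ such that $\int_0^1P_i(x)P_j(x)w(x;t)\,dx=h_j\delta_{ij}$ for $i,j\ge0$; $\mathbf p(j)$ is the coefficient of $x^{j-1}$ in $P_j$, $\mathbf p(0):=0$. $\beta_j=h_j/h_{j-1}$ for $j\ge1$ (distinct from the exponent $\beta$); $\beta_0$ only occurs multiplied by $0$ and may be set to $0$. Range of $z$: the identities are understood for $z\in\mathbb C\setminus\{0,1\}$ at which $v_{JS}'(z)$ is defined and the integrals involved converge. For $z\in(0,1)$, $v_{JS}'(z)$ is the ordinary derivative; for $z\notin[0,1]$ it denotes the value at $z$ of an analytic continuation of $v_{JS}'$, assumed to exist. Integrals are understood as improper integrals where they are not absolutely convergent. A prime denotes differentiation in $z$ (or $x$). *)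

(* Defs.v *)
From HB Require Import structures.
From mathcomp Require Import all_boot all_order all_algebra.
From mathcomp Require Import complex.
From mathcomp Require Import all_classical all_reals all_analysis.

Set Implicit Arguments.
Unset Strict Implicit.
Unset Printing Implicit Defensive.

Import Order.TTheory GRing.Theory Num.Theory.
Import numFieldNormedType.Exports.

Local Open Scope classical_set_scope.
Local Open Scope ring_scope.
Local Open Scope complex_scope.

(* [R[i]] seen as a [numFieldType], so that it gets the topology and the
   complex derivative of the library. *)
Definition Cnum (R : realType) : numFieldType := R[i].

(* [shift1 u n] is u_{n-1}, with u_{-1} = 0. *)
Definition shift1 (V : zmodType) (u : nat -> V) (n : nat) : V :=
  if n is m.+1 then u m else 0.

Section Improper.
Context {R : realType}.
Local Notation mu := (@lebesgue_measure R).

(* Improper integral of f from a to b: f may be singular at a, at b and at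
   finitely many interior points, which are introduced by [improper_split];
   the one-sided limits at a singular point are taken independently (no
   principal value).  For a Lebesgue integrable f the value is the Lebesgue
   integral, by dominated convergence. *)
Inductive is_improper_int (f : R -> R) : R -> R -> R -> Prop :=
| improper_limit (a b l : R) :
    a < b ->
    (forall c d : R, a < c -> c <= d -> d < b ->
       mu.-integrable `[c, d] (EFin \o f)) ->
    (fun p : R * R => \int[mu]_(x in `[p.1, p.2]) f x)
      @ filter_prod a^'+ b^'- --> l ->
    is_improper_int f a b l
| improper_split (a c b l1 l2 : R) :
    is_improper_int f a c l1 -> is_improper_int f c b l2 ->
    is_improper_int f a b (l1 + l2).

Definition is_cint01 (F : R -> R[i]) (l : R[i]) : Prop :=
  is_improper_int (fun x => complex.Re (F x)) 0 1 (complex.Re l) /\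
  is_improper_int (fun x => complex.Im (F x)) 0 1 (complex.Im l).

Definition ccvg01 (F : R -> R[i]) : Prop := exists l, is_cint01 F l.

Definition cint01 (F : R -> R[i]) : R[i] := xget 0 [set l | is_cint01 F l].

End Improper.

Section Weight.
Context {R : realType}.
Local Notation mu := (@lebesgue_measure R).

Definition theta (x : R) : R := if 0 < x then 1 else 0.

(* w_0 is only given on (0, 1); its values elsewhere are never used. *)
Definition wJS (alpha beta : R) (w0 : R -> R) (x : R) : R :=
  x `^ alpha * (1 - x) `^ beta * w0 x.

Definition vJS (alpha beta : R) (w0 : R -> R) (x : R) : R :=
  - ln (wJS alpha beta w0 x).

Definition weight (alpha beta : R) (w0 : R -> R) (t gamma A B : R) (x : R) : R :=
  wJS alpha beta w0 x * `|x - t| `^ gamma * (A + B * theta (x - t)).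

Definition admissible_w0 (w0 : R -> R) : Prop :=
  [/\ forall x : R, 0 < x < 1 -> 0 < w0 x,
      forall x : R, 0 < x < 1 -> derivable w0 x 1,
      forall x : R, 0 < x < 1 -> {for x, continuous (derive1 w0)},
      bounded_near w0 0^'+ & bounded_near w0 1^'-].

Definition finite_moments (wt : R -> R) : Prop :=
  forall j : nat, mu.-integrable `]0, 1[ (fun x => (x ^+ j * wt x)%:E).

(* The integrals are absolutely convergent, hence Lebesgue integrals. *)
Definition monic_OPs (wt : R -> R) (P : nat -> {poly R}) (h : nat -> R) : Prop :=
  (forall j, size (P j) = j.+1 /\ P j \is monic) /\
  (forall i j,
     \int[mu]_(x in `]0, 1[) ((P i).[x] * (P j).[x] * wt x)
     = if i == j then h j else 0).

Definition ceval (p : {poly R}) (z : R[i]) : R[i] :=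
  (map_poly (real_complex R) p).[z].

(* The coefficient of x^(n-1) in P_n, and 0 for n = 0. *)
Definition subcoef (P : nat -> {poly R}) (n : nat) : R :=
  if n is m.+1 then (P n)`_m else 0.

Definition beta_rec (h : nat -> R) (n : nat) : R :=
  if n is m.+1 then h n / h m else 0.

(* [d] is the value v'(z): the ordinary derivative if z is in (0, 1); if z is
   not in [0, 1], the value at z of a holomorphic function on a domain
   containing (0, 1) and z that extends v'. *)
Definition is_dv (v : R -> R) (z d : R[i]) : Prop :=
  (exists x : R, [/\ 0 < x < 1, z = x%:C & d = (derive1 v x)%:C]) \/
  ((forall x : R, 0 <= x <= 1 -> z <> x%:C) /\
   exists (D : set (Cnum R)) (F : Cnum R -> Cnum R),
     [/\ open D, connected D,
         forall u, D u -> derivable F u 1,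
         (forall x : R, 0 < x < 1 -> D (x%:C) /\ F (x%:C) = (derive1 v x)%:C)
       & D z /\ d = F z]).

End Weight.

Section Ladder.
Context {R : realType}.
(* wt is the full weight, v' its part without the factor at t, and dvz
   stands for v'(z). *)
Variables (v wt : R -> R) (t gamma : R) (P : nat -> {poly R}) (h : nat -> R).
Variables (z dvz : R[i]).

Definition v_kernel (x : R) : R[i] :=
  ((z - z ^+ 2) * dvz - ((x - x ^+ 2) * derive1 v x)%:C) / (z - x%:C).

Definition t_kernel (x : R) : R[i] :=
  (x - x ^+ 2)%:C / ((z - x%:C) * (x - t)%:C).

Definition pp (i j : nat) (x : R) : R[i] :=
  ((P i).[x] * (P j).[x] * wt x)%:C.

Definition A_cvg (n : nat) : Prop :=
  ccvg01 (fun x => v_kernel x * pp n n x) /\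
  ccvg01 (fun x => t_kernel x * pp n n x).

Definition A_coef (n : nat) : R[i] :=
  (z * (1 - z))^-1 *
  ((h n)%:C^-1 * cint01 (fun x => v_kernel x * pp n n x) + (2 * n + 1)%:R
   + gamma%:C / (h n)%:C * cint01 (fun x => t_kernel x * pp n n x)).

Definition B_cvg (n : nat) : Prop :=
  if n is m.+1 then
    ccvg01 (fun x => v_kernel x * pp m n x) /\
    ccvg01 (fun x => t_kernel x * pp m n x)
  else True.

Definition B_coef (n : nat) : R[i] :=
  if n is m.+1 then
    (z * (1 - z))^-1 *
    ((h m)%:C^-1 * cint01 (fun x => v_kernel x * pp m n x)
     + n%:R * (z - 1) - (subcoef P n)%:C
     + gamma%:C / (h m)%:C * cint01 (fun x => t_kernel x * pp m n x))
  else 0.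

End Ladder.

(* Main.v *)
(* For [Y = P_n] or [Y = P_(n-1)], both right-hand sides, multiplied by
   [z (1 - z)], contain the integral of a kernel against
   [Y(x) (P_n(x) P_(n-1)(z) - P_(n-1)(x) P_n(z)) w(x)].  The last difference is
   [(z - x) D(x)] for a polynomial [D] of degree [< n], so the denominator
   [z - x] disappears, and since [w'/w = - v' + gamma / (x - t)] what remains is
   [\int ((z - z^2) v'(z) w + (x - x^2) w') Y D].  One integrates by parts; the
   boundary terms vanish because [alpha, beta > -1], and there is no
   contribution of [t] because [gamma > 0].  The result follows from the
   reproducing property [\int D f w = - h_(n-1) f(z)] for [deg f < n] and from
   the leading coefficients of [D].
   As the two kernel integrals need only converge as improper integrals, with
   unrelated singular points, they are handled through continuous primitives,
   unique up to a constant off a finite set. *)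

Require Import Defs.
From HB Require Import structures.
From mathcomp Require Import all_boot all_order all_algebra.
From mathcomp Require Import complex.
From mathcomp Require Import all_classical all_reals all_analysis.
From mathcomp Require Import measurable_realfun ring.

Import Order.TTheory GRing.Theory Num.Theory.
Import numFieldNormedType.Exports.
Local Open Scope classical_set_scope.
Local Open Scope ring_scope.
Local Open Scope complex_scope.

Set Implicit Arguments.
Unset Strict Implicit.
Unset Printing Implicit Defensive.

(** * Algebra of the Christoffel-Darboux kernel for an abstract linear form *)

Lemma size_sub_lead (F : fieldType) (k : nat) (p q : {poly F}) :
  (size p <= k.+1)%N -> (size q <= k.+1)%N -> p`_k = q`_k ->
  (size (p - q)%R <= k)%N.
Proof.
move=> sp sq pq; apply/leq_sizeP => j; rewrite leq_eqVlt => /predU1P[<-|kj].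
  by rewrite coefB pq subrr.
by rewrite coefB !nth_default ?subrr// (leq_trans _ kj).
Qed.

Section KernelAlgebra.
Variables (F : fieldType) (L : {poly F} -> F).
Hypothesis L_linear : forall a p q, L (a *: p + q) = a * L p + L q.

Let L0 : L 0 = 0.
Proof. by have := L_linear (-1) 0 0; rewrite scaler0 addr0 mulN1r addNr. Qed.

Let LZ a p : L (a *: p) = a * L p.
Proof. by rewrite -[_ *: _]addr0 L_linear L0 addr0. Qed.

Let LD p q : L (p + q) = L p + L q.
Proof. by rewrite -{1}[p]scale1r L_linear mul1r. Qed.

Let LB p q : L (p - q) = L p - L q.
Proof. by rewrite LD -scaleN1r LZ mulN1r. Qed.

(** Since [P] is monic, subtracting [f_k P] from [f] leaves a polynomial of degree below [k], which
    is orthogonal to [P]. *)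
Lemma ortho_lead (k : nat) (P f : {poly F}) (h : F) :
  size P = k.+1 -> P \is monic ->
  (forall g : {poly F}, (size g <= k)%N -> L (P * g) = 0) -> L (P * P) = h ->
  (size f <= k.+1)%N -> L (P * f) = f`_k * h.
Proof.
move=> sP mP oP hP sf.
have Pk : P`_k = 1 by move/monicP: mP; rewrite /lead_coef sP.
have := oP (f - f`_k *: P); rewrite mulrBr -scalerAr LB LZ hP => /(_ _)/subr0_eq.
apply; apply: size_sub_lead => //.
  by rewrite (leq_trans (size_scale_leq _ _))// sP.
by rewrite coefZ Pk mulr1.
Qed.

Variables (m : nat) (P Q D : {poly F}) (hP hQ z : F).
Hypotheses (sP : size P = m.+1) (sQ : size Q = m.+2).
Hypotheses (mP : P \is monic) (mQ : Q \is monic).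
Hypothesis oP : forall g : {poly F}, (size g <= m)%N -> L (P * g) = 0.
Hypothesis oQ : forall g : {poly F}, (size g <= m.+1)%N -> L (Q * g) = 0.
Hypotheses (nP : L (P * P) = hP) (nQ : L (Q * Q) = hQ).
Hypothesis defD : (z%:P - 'X) * D = P.[z] *: Q - Q.[z] *: P.

Let Pm : P`_m = 1. Proof. by move/monicP: mP; rewrite /lead_coef sP. Qed.
Let Qm : Q`_m.+1 = 1. Proof. by move/monicP: mQ; rewrite /lead_coef sQ. Qed.

(** [D] is, up to a constant factor, the Christoffel-Darboux kernel at [z]. The right-hand side of
    [defD] has degree at most [m + 1], and the factor [z - X] accounts for one degree. *)
Lemma kernel_size : (size D <= m.+1)%N.
Proof.
have [->|D0] := eqVneq D 0; first by rewrite size_poly0.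
have s1 : size (z%:P - 'X) = 2 by rewrite -opprB size_polyN size_XsubC.
have z0 : z%:P - 'X != 0 :> {poly F} by rewrite -size_poly_eq0 s1.
suff: (size ((z%:P - 'X) * D)%R <= m.+2)%N by rewrite size_mul// s1.
rewrite defD (leq_trans (size_polyD _ _))// size_polyN geq_max.
by rewrite !(leq_trans (size_scale_leq _ _)) ?sP ?sQ.
Qed.

(** Comparison of the coefficients of [X^(m+1)] in [defD]: the left one is [- D_m], and on the right
    only [Q] contributes. *)
Lemma kernel_lead : D`_m = - P.[z].
Proof.
have := congr1 (fun p : {poly F} => p`_m.+1) defD.
rewrite mulrBl coefB coefCM coefXM /= coefB !coefZ Qm.
rewrite [D`_m.+1]nth_default ?kernel_size// [P`_m.+1]nth_default ?sP//.
by rewrite !mulr0 mulr1 sub0r subr0 => /eqP; rewrite eqr_oppLR => /eqP.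
Qed.

(* [('X * D)`_m] is the coefficient of [x^(m-1)] in [D], and [0] if [m = 0]. *)
Lemma kernel_sublead : ('X * D)`_m = Q.[z] - P.[z] * (z + Q`_m).
Proof.
have := congr1 (fun p : {poly F} => p`_m) defD.
rewrite mulrBl !coefB coefCM !coefZ Pm kernel_lead => E.
rewrite -[LHS](subKr (z * - P.[z])) E; ring.
Qed.

Let LPD : L (P * D) = - P.[z] * hP.
Proof. by rewrite (ortho_lead sP mP oP nP) ?kernel_size// kernel_lead. Qed.

Lemma sub_eval_factor (f : {poly F}) (k : nat) : (size f <= k.+1)%N ->
  exists2 g : {poly F}, (size g <= k)%N & f - f.[z]%:P = g * ('X - z%:P).
Proof.
move=> sf; have /factor_theorem[g fg] : root (f - f.[z]%:P) z.
  by rewrite /root !hornerE subrr.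
exists g => //; have [->|g0] := eqVneq g 0; first by rewrite size_poly0.
suff: (size (g * ('X - z%:P))%R <= k.+1)%N by
  rewrite size_Mmonic ?monicXsubC// size_XsubC addn2.
rewrite -fg (leq_trans (size_polyD _ _))// size_polyN geq_max sf.
by rewrite (leq_trans (size_polyC_leq1 _)).
Qed.

(* Writing [f = f(z) + (x - z) g], the factor [x - z] turns [D] into a
   combination of [P] and [Q], both orthogonal to [g]. *)
Let reproduce_cst (f : {poly F}) : (size f <= m.+1)%N ->
  L (D * f) = f.[z] * L D.
Proof.
move=> /sub_eval_factor[g sg fg].
have -> : D * f = f.[z] *: D + (Q.[z] *: (P * g) - P.[z] *: (Q * g)).
  rewrite -[f in LHS](subrK f.[z]%:P) fg mulrDr.
  rewrite -[_ * _%:P]mulrC mul_polyC addrC; congr (_ + _).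
  transitivity (- ((z%:P - 'X) * D) * g); first by ring.
  by rewrite defD opprB mulrBl !scalerAl.
by rewrite L_linear LB !LZ oP// oQ ?(leqW sg)// !mulr0 subrr addr0.
Qed.

(** This fixes the constant in the reproducing property. If [P(z)] is nonzero, testing against
    [f = P] and comparing with [LPD] gives it; a zero of [P] at [z] needs another test
    polynomial. *)
Let LD1 : L D = - hP.
Proof.
have [Pz|Pz] := eqVneq P.[z] 0; last first.
  apply: (mulfI Pz); rewrite -reproduce_cst ?sP// mulrC LPD; ring.
(* [P = (x - z) g] and [D = Q(z) g]; pair [g] with [(x - z) P - Q]. *)
have [g sg Pg] : exists2 g : {poly F},
    (size g <= m)%N & P - P.[z]%:P = g * ('X - z%:P).
  by apply: sub_eval_factor; rewrite sP.
rewrite Pz subr0 in Pg.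
have Dg : D = Q.[z] *: g.
  apply: (mulfI (_ : z%:P - 'X != 0)).
    by rewrite -size_poly_eq0 -opprB size_polyN size_XsubC.
  rewrite defD Pz scale0r sub0r Pg -!mul_polyC; ring.
(* The top terms of [f] cancel, so [f] is short enough for the reduction to [f(z)], and
   [f(z) = - Q(z)]. Moreover [g f = P^2 - Q g], whose image under [L] is [hP]. *)
pose f := ('X - z%:P) * P - Q.
have sf : (size f <= m.+1)%N.
  apply: size_sub_lead; rewrite ?sQ//.
    by rewrite mulrC size_Mmonic ?monicXsubC ?monic_neq0// size_XsubC sP addn2.
  rewrite Qm mulrBl coefB coefXM/= coefCM Pm [P`_m.+1]nth_default ?sP//.
  by rewrite mulr0 subr0.
have [s ss fs] := sub_eval_factor sf.
have Lgf : L (g * f) = f.[z] * L g.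
  have -> : g * f = f.[z] *: g + P * s.
    by rewrite -[f in LHS](subrK f.[z]%:P) fs Pg -mul_polyC; ring.
  by rewrite L_linear oP// addr0.
have : L (g * f) = hP.
  have -> : g * f = P * P - Q * g by rewrite /f Pg; ring.
  by rewrite LB nP oQ ?subr0 ?(leqW sg).
rewrite Lgf /f !hornerE subrr mul0r sub0r => <-.
by rewrite Dg LZ mulNr opprK.
Qed.

Lemma kernel_reproducing (f : {poly F}) : (size f <= m.+1)%N ->
  L (D * f) = - hP * f.[z].
Proof. by move=> sf; rewrite reproduce_cst// LD1 mulrC. Qed.

Let q : {poly F} := 'X - 'X^2.

Let q_eval : q.[z] = z - z ^+ 2. Proof. by rewrite !hornerE. Qed.

Let coef_qM (p : {poly F}) k : (q * p)`_k.+1 = p`_k - ('X * p)`_k.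
Proof. by rewrite mulrBl coefB expr2 -mulrA !(coefXM _ k.+1). Qed.

Let coef_Xderiv (p : {poly F}) k : ('X * p^`())`_k = p`_k *+ k.
Proof. by rewrite coefXM; case: k => [|k]; rewrite ?mulr0n// coef_deriv. Qed.

Let coef_deriv_qM (p : {poly F}) k :
  ((q * p)^`())`_k = (p`_k - ('X * p)`_k) *+ k.+1.
Proof. by rewrite coef_deriv coef_qM. Qed.

(** The derivative is written as [Q] times a polynomial of degree at most [m + 1], evaluated by its
    top coefficient, plus [D] times a polynomial of degree at most [m], evaluated by the reproducing
    property. *)
Lemma kernel_deriv_Q :
  L (('X - 'X^2) * Q * D)^`() =
  (2 * m.+1 + 1)%:R * P.[z] * hQ
  - hP * ((z - z ^+ 2) * Q^`().[z] + (m.+1%:R * (z - 1) - Q`_m) * Q.[z]).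
Proof.
rewrite -/q -q_eval.
have sD := kernel_size; have Dm := kernel_lead.
pose n := m.+1.
(* [n (x - s) Q] with [n s = n + Q_m] cancels the two top terms of [q Q']. *)
pose f := q * Q^`() + (n%:R *: 'X - (n%:R + Q`_m)%:P) * Q.
have -> : (q * Q * D)^`() =
    Q * ((q * D)^`() - (n%:R *: ('X * D) - (n%:R + Q`_m) *: D)) + D * f.
  rewrite !derivM /f -!mul_polyC; ring.
have sf : (size f <= m.+1)%N.
  apply/leq_sizeP => -[//|k]; rewrite ltnS /f => mk.
  rewrite coefD coef_qM coef_Xderiv coef_deriv mulrBl coefB -scalerAl coefZ
    coefXM coefCM /=.
  move: mk; rewrite leq_eqVlt => /predU1P[<-|]; first by rewrite Qm /n; ring.
  rewrite leq_eqVlt => /predU1P[<-|mk].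
    by rewrite Qm [Q`_m.+2]nth_default ?sQ// /n; ring.
  by rewrite [Q`_k.+1]nth_default ?[Q`_k]nth_default ?sQ ?(leqW mk)//; ring.
rewrite LD kernel_reproducing// (ortho_lead sQ mQ oQ nQ); last first.
  apply/leq_sizeP => -[//|k]; rewrite ltnS => mk.
  rewrite !coefB coef_deriv_qM !coefZ coefXM /=.
  by rewrite [D`_k.+1]nth_default ?[D`_k]nth_default ?(leq_trans sD)//
    1?ltnW//; ring.
have fz : f.[z] = q.[z] * Q^`().[z] + (n%:R * (z - 1) - Q`_m) * Q.[z].
  by rewrite /f !(hornerE, hornerX, hornerC); ring.
rewrite fz mulNr; congr (_ - _); congr (_ * _).
rewrite !coefB coef_deriv_qM !coefZ coefXM /= Dm [D`_m.+1]nth_default// /n; ring.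
Qed.

Lemma kernel_deriv_P :
  L (('X - 'X^2) * P * D)^`() =
  hP * ((m.+1%:R * (z - 1) - Q`_m) * P.[z] - (2 * m + 1)%:R * Q.[z]
        - (z - z ^+ 2) * P^`().[z]).
Proof.
rewrite -/q -q_eval.
have sD := kernel_size; have Dm := kernel_lead; have XDm := kernel_sublead.
(* The terms of degree [m + 1] are [- m] in [q P'] and [(m + 2) P(z)] in [(q D)']; multiples of [Q]
   remove both. The corrections add up to [Q] times a polynomial of degree at most [m], which [L]
   annihilates. *)
pose f := q * P^`() + m%:R *: Q.
pose g := (q * D)^`() - (m.+2%:R * P.[z]) *: Q.
have -> : (q * P * D)^`() =
    P * g + Q * ((m.+2%:R * P.[z]) *: P - m%:R *: D) + D * f.
  rewrite /f /g -!mul_polyC !derivM; ring.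
have sf : (size f <= m.+1)%N.
  apply/leq_sizeP => -[//|k]; rewrite ltnS /f => mk.
  rewrite coefD coef_qM coef_Xderiv coef_deriv coefZ.
  move: mk; rewrite leq_eqVlt => /predU1P[<-|mk].
    by rewrite Pm Qm [P`_m.+1]nth_default ?sP//; ring.
  by rewrite [P`_k.+1]nth_default ?[P`_k]nth_default ?[Q`_k.+1]nth_default ?sP
    ?sQ ?(leqW mk)//; ring.
have sg : (size g <= m.+1)%N.
  apply/leq_sizeP => -[//|k]; rewrite ltnS /g => mk.
  rewrite coefB coef_deriv_qM coefZ coefXM /= [D`_k.+1]nth_default ?(leq_trans
    sD)//.
  move: mk; rewrite leq_eqVlt => /predU1P[<-|mk]; first by rewrite Qm Dm; ring.
  by rewrite [D`_k]nth_default ?[Q`__]nth_default ?sQ ?(leq_trans sD)//; ring.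
rewrite !LD kernel_reproducing// (ortho_lead sP mP oP nP sg) oQ; last first.
  rewrite (leq_trans (size_polyD _ _))// size_polyN geq_max.
  by rewrite !(leq_trans (size_scale_leq _ _)) ?sP.
have fz : f.[z] = q.[z] * P^`().[z] + m%:R * Q.[z].
  by rewrite /f !hornerE.
have gm : g`_m = m.+1%:R * ((z - 1) * P.[z] + P.[z] * Q`_m - Q.[z])
    - m.+2%:R * P.[z] * Q`_m.
  by rewrite /g coefB coef_deriv_qM coefZ Dm XDm; ring.
by rewrite fz gm; ring.
Qed.

End KernelAlgebra.

(** * Improper integrals as increments of continuous primitives *)

Section ImproperPrimitive.
Context {R : realType}.
Local Notation mu := (@lebesgue_measure R).

(** The integrand is controlled only on closed intervals avoiding [S], while [F] is continuous
    through the points of [S] and up to the ends. Hence [S] may be enlarged freely, and integrals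
    with different singular points can be combined. *)
Definition primitive_off (S : seq R) (a b : R) (f F : R -> R) : Prop :=
  {within `[a, b], continuous F} /\
  forall c d, a < c -> c <= d -> d < b ->
    (forall s, s \in S -> ~~ (c <= s <= d)) ->
    mu.-integrable `[c, d] (EFin \o f) /\
    \int[mu]_(x in `[c, d]) f x = F d - F c.

(** Freezing the second variable at one admissible value shows that [phi] satisfies the Cauchy
    criterion. *)
Lemma cvg_prod_addl (T U : Type) (F : set_system T) (G : set_system U)
    {FF : ProperFilter F} {FG : ProperFilter G}
    (phi : T -> R) (psi : U -> R) (l : R) :
  (fun p => phi p.1 + psi p.2) @ filter_prod F G --> l -> cvg (phi @ F).
Proof.
move=> /cvgrPdist_lt cl; apply/cauchy_cvgP/cauchy_exP => e e0.
have [[A B] /= [FA GB] AB] := cl _ e0.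
have [y By] := filter_ex GB.
exists (l - psi y); apply: filterS FA => x Ax.
by rewrite /ball /= -addrA -opprD (addrC (psi y)); exact: (AB (x, y)).
Qed.

Lemma cvg_prod_addr (T U : Type) (F : set_system T) (G : set_system U)
    {FF : ProperFilter F} {FG : ProperFilter G}
    (phi : T -> R) (psi : U -> R) (l : R) :
  (fun p => phi p.1 + psi p.2) @ filter_prod F G --> l -> cvg (psi @ G).
Proof.
move=> /cvgrPdist_lt cl; apply/cauchy_cvgP/cauchy_exP => e e0.
have [[A B] /= [FA GB] AB] := cl _ e0.
have [x Ax] := filter_ex FA.
exists (l - phi x); apply: filterS GB => y By.
by rewrite /ball /= -addrA -opprD; exact: (AB (x, y)).
Qed.

Lemma Rintegral_itv_chasles (f : R -> R) (c x d : R) : c <= x -> x <= d ->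
  mu.-integrable `[c, d] (EFin \o f) ->
  \int[mu]_(y in `[c, d]) f y =
  \int[mu]_(y in `[c, x]) f y + \int[mu]_(y in `[x, d]) f y.
Proof.
move=> cx xd fi; rewrite -(@Rintegral_itv_obnd_cbnd _ x); last first.
  by apply: integrableS fi => //; apply: subset_itvr; rewrite bnd_simp.
by rewrite -(Rintegral_itvB fi) ?bnd_simp// addrC subrK.
Qed.

Lemma Rintegral_itv_eq0 (f : R -> R) (c d : R) : d <= c ->
  \int[mu]_(y in `[c, d]) f y = 0.
Proof.
rewrite le_eqVlt => /predU1P[->|dc]; first by rewrite set_itv1 Rintegral_set1.
by rewrite set_itv_ge ?Rintegral_set0// bnd_simp -ltNge.
Qed.

(** Cutting at the midpoint [e] writes the integral over [[c, d]] as [phi c + psi d]. The joint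
    limit forces both one-sided limits to exist, and they provide the end values of the
    primitive. *)
Lemma primitive_of_improper_limit (f : R -> R) (a b l : R) : a < b ->
  (forall c d : R, a < c -> c <= d -> d < b ->
     mu.-integrable `[c, d] (EFin \o f)) ->
  (fun p : R * R => \int[mu]_(x in `[p.1, p.2]) f x)
    @ filter_prod a^'+ b^'- --> l ->
  exists2 F, primitive_off [::] a b f F & l = F b - F a.
Proof.
move=> ab fi fl; pose e := (a + b) / 2.
have [ae eb] := midf_lt ab.
pose phi c := \int[mu]_(x in `[c, e]) f x.
pose psi d := \int[mu]_(x in `[e, d]) f x.
have fl' : (fun p : R * R => phi p.1 + psi p.2) @ filter_prod a^'+ b^'- --> l.
  apply: cvg_trans fl; apply: near_eq_cvg.
  exists ([set x | a < x < e], [set x | e < x < b]) => /=.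
    split; near=> x; apply/andP; split; near: x;
      [exact: nbhs_right_gt|exact: nbhs_right_lt
      |exact: nbhs_left_gt|exact: nbhs_left_lt].
  move=> [c d] /= [/andP[ac ce] /andP[ed db]].
  by rewrite /phi /psi -Rintegral_itv_chasles ?ltW ?fi// ltW// (lt_trans ce).
have phia : cvg (phi @ a^'+) by exact: cvg_prod_addl fl'.
have psib : cvg (psi @ b^'-) by exact: cvg_prod_addr fl'.
set la := lim _ in phia; set lb := lim _ in psib.
have lE : l = la + lb.
  apply: cvg_unique fl' _ => //.
  by apply: cvgD; [exact: cvg_comp cvg_fst phia | exact: cvg_comp cvg_snd psib].
(* An integral over a reversed interval is [0], so [psi] vanishes left of [e] and [phi] right of
   [e]; thus [G] is the signed integral from [e] to [x]. *)
pose G x := psi x - phi x.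
have GB c d : a < c -> c <= d -> d < b -> \int[mu]_(x in `[c, d]) f x = G d - G c.
  move=> ac cd db; have ad := lt_le_trans ac cd; have cb := le_lt_trans cd db.
  rewrite /G /phi /psi; have [de|/ltW ed] := leP d e.
    rewrite (Rintegral_itv_chasles cd de) ?fi ?(le_trans cd)//.
    by rewrite !(@Rintegral_itv_eq0 _ e) ?(le_trans cd)//; ring.
  have [ec|/ltW ce] := leP e c.
    rewrite (Rintegral_itv_chasles ec cd) ?fi ?(le_trans cd)//.
    by rewrite !(@Rintegral_itv_eq0 _ _ e)//; ring.
  rewrite (Rintegral_itv_chasles ce ed) ?fi//.
  by rewrite (@Rintegral_itv_eq0 _ e c)// (@Rintegral_itv_eq0 _ d e)//; ring.
pose F x := if x <= a then - la else if b <= x then lb else G x.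
have FG x : a < x < b -> F x = G x.
  by move=> /andP[ax xb]; rewrite /F leNgt ax leNgt xb.
have Fa : F a = - la by rewrite /F lexx.
have Fb : F b = lb by rewrite /F lexx leNgt ab.
clearbody F.
exists F; last by rewrite lE Fa Fb opprK; exact: addrC.
split; last first.
  move=> c d ac cd db _; split; first exact: fi.
  by rewrite GB// !FG// ?ac ?db ?(le_lt_trans cd) ?(lt_le_trans ac).
apply/continuous_within_itvP => //; split.
- move=> x /[!in_itv]/= /andP[ax xb].
  (* Continuity at an interior point is read off an auxiliary interval [[c, d]] around [x] on which
     [f] is Lebesgue integrable. *)
  pose c := (a + x) / 2; pose d := (x + b) / 2.
  have [[ac cx] [xd db]] := (midf_lt ax, midf_lt xb).
  have cd : c < d by apply: lt_trans xd.
  have /continuous_within_itvP -/(_ cd)[/(_ x) + _ _] :=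
    parameterized_integral_continuous (ltW cd) (fi _ _ ac (ltW cd) db).
  rewrite in_itv /= cx xd => /(_ isT) cI.
  have IE y : c <= y -> y <= d ->
      \int[mu]_(u in `[c, y]) f u + G c = F y.
    move=> cy yd; rewrite GB ?(le_lt_trans yd)// FG ?subrK//.
    by rewrite (lt_le_trans ac)// (le_lt_trans yd).
  rewrite /continuous_at -IE ?ltW//.
  apply: cvg_trans (cvgD cI (cvg_cst (G c))); apply: near_eq_cvg; near=> y.
  by rewrite /= -IE//; apply: ltW; near: y; [exact: lt_nbhsr|exact: lt_nbhsl].
- rewrite Fa; apply: cvg_trans (cvgN phia); apply: near_eq_cvg; near=> x.
  have xe : x < e by near: x; exact: nbhs_right_lt.
  rewrite FG /G /psi ?Rintegral_itv_eq0 ?sub0r ?ltW//.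
  by rewrite (lt_trans xe)// andbT; near: x; exact: nbhs_right_gt.
- rewrite Fb; apply: cvg_trans psib; apply: near_eq_cvg; near=> x.
  have ex : e < x by near: x; exact: nbhs_left_gt.
  rewrite FG /G /phi ?Rintegral_itv_eq0 ?subr0 ?ltW//.
  by rewrite (lt_trans ae ex)//; near: x; exact: nbhs_left_lt.
Unshelve. all: by end_near.
Qed.

(** Both primitives are normalised to vanish at [c], so they match there. Listing [c] as exceptional
    means that no interval to be checked contains it. *)
Lemma primitive_off_glue (S1 S2 : seq R) (a c b : R) (f F1 F2 : R -> R) :
  a < c -> c < b -> primitive_off S1 a c f F1 -> primitive_off S2 c b f F2 ->
  primitive_off (c :: S1 ++ S2) a b f
    (fun x => if x <= c then F1 x - F1 c else F2 x - F2 c).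
Proof.
move=> ac cb [cF1 F1P] [cF2 F2P]; set F := (fun x => _); split.
  have -> : `[a, b]%classic = `[a, c] `|` `[c, b] :> set R.
    apply/seteqP; split => x /=; rewrite !in_itv/=.
      by move=> /andP[ax xb]; have [xc|/ltW cx] := leP x c; [left|right];
        apply/andP.
    by case=> /andP[h1 h2]; apply/andP; split => //;
      [exact: le_trans (ltW cb)|exact: le_trans (ltW ac) h1].
  apply: withinU_continuous; [exact: interval_closed..| |].
    apply: (@subspace_eq_continuous _ _ _ (fun x => F1 x - F1 c)).
      by move=> x; rewrite inE/= in_itv/= => /andP[_ xc];
        rewrite /F /from_subspace/= xc.
    by apply: within_continuousB => // x; exact: cvg_cst.
  apply: (@subspace_eq_continuous _ _ _ (fun x => F2 x - F2 c)).
    move=> x; rewrite inE/= in_itv/= => /andP[cx _]; rewrite /F /from_subspace/=.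
    by case: ifPn => // xc; rewrite (@le_anti _ _ x c) ?xc// !subrr.
  by apply: within_continuousB => // x; exact: cvg_cst.
move=> u v au uv vb nS.
have : ~~ (u <= c <= v) by apply: nS; rewrite mem_head.
rewrite negb_and -!ltNge => /orP[cu|vc].
  have [] := F2P u v cu uv vb _.
    by move=> s sS; apply: nS; rewrite inE mem_cat sS !orbT.
  move=> fi ->; split => //; rewrite /F leNgt (lt_le_trans cu)//= leNgt cu /=; ring.
have [] := F1P u v au uv vc _.
  by move=> s sS; apply: nS; rewrite inE mem_cat sS orbT.
move=> fi ->; split => //; rewrite /F (ltW vc)//= (le_trans uv (ltW vc)) /=; ring.
Qed.

Lemma primitive_of_improper (f : R -> R) (a b l : R) : is_improper_int f a b l ->
  a < b /\ exists S F, primitive_off S a b f F /\ l = F b - F a.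
Proof.
elim=> {a b l} [a b l ab fi fl|
    a c b l1 l2 _ [ac [S1 [F1 [P1 ->]]]] _ [cb [S2 [F2 [P2 ->]]]]].
  split => //; have [F FP lF] := primitive_of_improper_limit ab fi fl.
  by exists [::], F.
split; first exact: lt_trans cb.
exists (c :: S1 ++ S2); eexists; split; first exact: primitive_off_glue P1 P2.
by rewrite /= leNgt cb (ltW ac) /=; ring.
Qed.

(** Applied to a difference, this is the uniqueness of primitives up to a constant. Induction on
    [S]: an exceptional point inside []a, b[] splits the interval, any other is dropped; with none
    left, [F] is constant inside and continuity reaches the ends. *)
Lemma eq_ends_of_locally_cst (S : seq R) (a b : R) (F : R -> R) : a < b ->
  {within `[a, b], continuous F} ->
  (forall c d, a < c -> c <= d -> d < b ->
    (forall s, s \in S -> ~~ (c <= s <= d)) -> F c = F d) ->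
  F a = F b.
Proof.
elim: S a b => [|s S IH] a b ab cF Fcst.
  have /continuous_within_itvP -/(_ ab)[_ Fa Fb] := cF.
  pose e := (a + b) / 2.
  have [ae eb] := midf_lt ab.
  have cste (G : set_system R) : Filter G -> cst (F e) @ G --> F e.
    by move=> ?; exact: cvg_cst.
  transitivity (F e).
    apply: cvg_unique Fa _ => //; apply: cvg_trans (cste a^'+ _).
    apply: near_eq_cvg; near=> x; symmetry; apply: Fcst => //.
    by apply: ltW; near: x; exact: nbhs_right_lt.
  symmetry; apply: cvg_unique Fb _ => //; apply: cvg_trans (cste b^'- _).
  apply: near_eq_cvg; near=> x; apply: Fcst => //.
  by apply: ltW; near: x; exact: nbhs_left_gt.
have [/andP[as_ sb]|nsab] := boolP (a < s < b).
  transitivity (F s); apply: IH => //.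
  - by apply: continuous_subspaceW cF; apply: subset_itvl; rewrite bnd_simp ltW.
  - move=> c d ac cd ds nS; apply: Fcst => //; first exact: lt_trans sb.
    move=> r; rewrite inE => /predU1P[->|]; last exact: nS.
    by rewrite negb_and -!ltNge ds orbT.
  - by apply: continuous_subspaceW cF; apply: subset_itvr; rewrite bnd_simp ltW.
  - move=> c d ac cd ds nS; apply: Fcst => //; first exact: lt_trans ac.
    move=> r; rewrite inE => /predU1P[->|]; last exact: nS.
    by rewrite negb_and -!ltNge ac.
apply: IH => // c d ac cd db nS; apply: Fcst => // r; rewrite inE => /predU1P[->|].
  apply: contraNN nsab => /andP[cs sd].
  by rewrite (lt_le_trans ac)// (le_lt_trans sd).
exact: nS.
Unshelve. all: by end_near.
Qed.

End ImproperPrimitive.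

(** * Regularity of the weight and its logarithmic derivative *)

Section WeightAnalysis.
Context {R : realType}.
Local Notation mu := (@lebesgue_measure R).

Lemma continuous_norm_powR (r : R) : 0 < r -> continuous (fun x : R => `|x| `^ r).
Proof.
move=> r0 x; have [->|x0] := eqVneq x 0; last first.
  apply: (@continuous_comp _ _ _ (fun y : R => `|y|) (fun y : R => y `^ r));
    first exact: norm_continuous.
  apply/differentiable_continuous/derivable1_diffP.
  by apply: ex_derive; apply: is_derive1_powR; rewrite normr_gt0.
rewrite /continuous_at normr0 powR0 ?gt_eqF//; apply/cvgrPdist_lt => e e0.
near=> y; rewrite sub0r normrN ger0_norm ?powR_ge0//.
have -> : e = (e `^ r^-1) `^ r by rewrite -powRrM mulVf ?gt_eqF// powRr1// ltW.
apply: gt0_ltr_powR => //; rewrite ?nnegrE ?powR_ge0//.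
by near: y; exists (e `^ r^-1) => /= [|z]; [exact: powR_gt0|rewrite /ball_ /=
  sub0r normrN].
Unshelve. all: by end_near. Qed.

(* The jump of [theta] at [t] is cancelled by the zero of [|x - t|^gamma]. *)
Lemma continuous_jump_factor (t gamma A B : R) : 0 < gamma ->
  continuous (fun x => `|x - t| `^ gamma * (A + B * theta (x - t))).
Proof.
move=> g0.
(* Here [(x - t + |x - t|) / 2] is the positive part of [x - t], whose power absorbs [theta]. *)
have -> : (fun x => `|x - t| `^ gamma * (A + B * theta (x - t))) =
    (fun x => A * `|x - t| `^ gamma + B * `|(x - t + `|x - t|) / 2| `^ gamma).
  apply/funext => x; rewrite /theta; case: ifPn => xt.
    have -> : (x - t + `|x - t|) / 2 = x - t by rewrite (gtr0_norm xt); field.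
    by ring.
  rewrite -leNgt in xt.
  have -> : (x - t + `|x - t|) / 2 = 0 by rewrite (ler0_norm xt) subrr mul0r.
  by rewrite normr0 powR0 ?gt_eqF// !mulr0 !addr0 mulrC.
move=> x.
have cs : {for x, continuous (fun x => x - t)}.
  by apply: continuousB; [exact: cvg_id|exact: cvg_cst].
apply: cvgD; apply: cvgM; (try exact: cvg_cst).
  by apply: (@continuous_comp _ _ _ (fun x : R => x - t)
    (fun y : R => `|y| `^ gamma)) => //; exact: continuous_norm_powR.
apply: (@continuous_comp _ _ _ (fun x : R => (x - t + `|x - t|) / 2)
  (fun y : R => `|y| `^ gamma)); last exact: continuous_norm_powR.
apply: continuousM; last exact: cvg_cst.
apply: continuousD => //.
by apply: (@continuous_comp _ _ _ (fun x : R => x - t) (fun y : R => `|y|)) =>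
  //; exact: norm_continuous.
Qed.

Lemma cvg0_dominated (F : set_system R) {FF : Filter F} (u k : R -> R) (M : R) :
  (\forall x \near F, `|u x| <= M * k x) -> k @ F --> 0 -> u @ F --> 0.
Proof.
move=> uk k0; have Mk : (fun x => M * k x) @ F --> 0.
  by rewrite -[X in _ --> X](mulr0 M); apply: cvgM => //; exact: cvg_cst.
apply: (squeeze_cvgr _ _ Mk); last first.
  by rewrite -[X in _ --> X]oppr0; exact: (cvgN Mk).
by near do rewrite -ler_norml.
Unshelve. all: by end_near. Qed.

Lemma bounded_near_bound (F : set_system R) (f : R -> R) :
  bounded_near f F -> exists2 M, 0 < M & F [set x | `|f x| <= M].
Proof.
move=> [M [_ hM]]; exists (`|M| + 1); first by rewrite ltr_wpDl.
by apply: hM; rewrite (le_lt_trans (ler_norm M))// ltrDl.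
Qed.

Variables (alpha beta : R) (w0 : R -> R).
Hypotheses (halpha : -1 < alpha) (hbeta : -1 < beta) (hw0 : admissible_w0 w0).
Local Notation wJ := (wJS alpha beta w0).
Local Notation vJ := (vJS alpha beta w0).

Lemma wJS_gt0 (x : R) : 0 < x < 1 -> 0 < wJ x.
Proof.
move=> x01; have [w0_gt0 _ _ _ _] := hw0; have /andP[x0 x1] := x01.
by rewrite /wJS !mulr_gt0 ?powR_gt0 ?subr_gt0 ?w0_gt0.
Qed.

Let dv (x : R) := - (alpha / x - beta / (1 - x) + derive1 w0 x / w0 x).

Lemma is_derive_vJS (x : R) : 0 < x < 1 -> is_derive x 1 vJ (dv x).
Proof.
move=> x01; have [w0_gt0 w0_d _ _ _] := hw0; have /andP[x0 x1] := x01.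
have dw0 : is_derive x 1 w0 (derive1 w0 x).
  by rewrite derive1E; apply: DeriveDef => //; exact: w0_d.
have w0x := w0_gt0 _ x01.
apply: (@near_eq_is_derive _ _ _ (fun y => - (alpha * ln y + beta * ln (1 - y)
  + ln (w0 y)))).
- near=> y; have y01 : 0 < y < 1.
    by apply/andP; split; near: y; [exact: lt_nbhsr|exact: lt_nbhsl].
  have /andP[y0 y1] := y01; rewrite /vJS /wJS.
  by rewrite !lnM ?posrE ?mulr_gt0 ?powR_gt0 ?subr_gt0 ?w0_gt0// !ln_powR.
have dln : is_derive x 1 (@ln R) x^-1 by exact: is_derive1_ln.
have d1x : is_derive x 1 (fun y => 1 - y) (0 - 1).
  exact: is_deriveB.
have dl1x : is_derive x 1 (fun y => ln (1 - y)) ((1 - x)^-1 * (0 - 1)).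
  have x1' : 0 < 1 - x by rewrite subr_gt0.
  exact: (@is_derive1_comp R (@ln R) (fun y => 1 - y) x _ _ (is_derive1_ln x1')
    d1x).
have dlw : is_derive x 1 (fun y => ln (w0 y)) ((w0 x)^-1 * derive1 w0 x).
  exact: (@is_derive1_comp R (@ln R) w0 x _ _ (is_derive1_ln w0x) dw0).
have := is_deriveN (is_deriveD (is_deriveD (is_deriveZ alpha dln) (is_deriveZ
  beta dl1x)) dlw).
move=> D; apply: (is_derive_eq D); rewrite /dv /GRing.scale /=; ring.
Unshelve. all: by end_near. Qed.

Lemma derive1_vJS (x : R) : 0 < x < 1 -> derive1 vJ x = dv x.
Proof. by move=> /is_derive_vJS dvx; rewrite derive1E; exact: derive_val. Qed.

Lemma continuous_derive1_vJS (x : R) : 0 < x < 1 ->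
  {for x, continuous (derive1 vJ)}.
Proof.
move=> x01; have [w0_gt0 w0_d w0_c _ _] := hw0; have /andP[x0 x1] := x01.
have cdv : {for x, continuous dv}.
  have cid : {for x, continuous (fun y : R => y)} by exact: cvg_id.
  have c1 : {for x, continuous (fun y : R => 1 - y)}.
    by apply: continuousB => //; exact: cvg_cst.
  have cw0 : {for x, continuous w0}.
    by apply/differentiable_continuous/derivable1_diffP/w0_d.
  apply: continuousN; apply: continuousD; first apply: continuousB.
  - by apply: continuousM; [exact: cvg_cst|apply: continuousV; rewrite ?gt_eqF].
  - by apply: continuousM; [exact: cvg_cst|apply: continuousV;
    rewrite ?gt_eqF ?subr_gt0].
  - by apply: continuousM; [exact: w0_c|apply: continuousV;
    rewrite ?gt_eqF ?w0_gt0].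
rewrite /prop_for /continuous_at derive1_vJS//; apply: cvg_trans cdv;
  apply: near_eq_cvg.
near=> y; rewrite derive1_vJS//.
by apply/andP; split; near: y; [exact: lt_nbhsr|exact: lt_nbhsl].
Unshelve. all: by end_near. Qed.

Lemma is_derive_wJS (x : R) : 0 < x < 1 -> is_derive x 1 wJ (- derive1 vJ x * wJ x).
Proof.
move=> x01; have /andP[x0 x1] := x01.
have dvx := is_derive_vJS x01; rewrite -derive1_vJS// in dvx.
apply: (@near_eq_is_derive _ _ _ (fun y => expR (- vJ y))).
- near=> y; rewrite /vJS opprK lnK// posrE wJS_gt0//.
  by apply/andP; split; near: y; [exact: lt_nbhsr|exact: lt_nbhsl].
have D : is_derive x 1 (fun y => expR (- vJ y)) (expR (- vJ x) * - derive1 vJ x).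
  exact: (@is_derive1_comp R expR (fun y => - vJ y) x _ _ (is_derive_expR _)
    (is_deriveN dvx)).
apply: (is_derive_eq D); rewrite /vJS opprK lnK ?posrE ?wJS_gt0//.
by rewrite mulrC.
Unshelve. all: by end_near. Qed.

(** The factor [x - x^2] raises both exponents by one, which makes them positive. Absolute values
    allow [continuous_norm_powR] to be used across the endpoints. *)
Let q_wJSE (x : R) : 0 < x < 1 ->
  (x - x ^+ 2) * wJ x = `|x| `^ (alpha + 1) * `|1 - x| `^ (beta + 1) * w0 x.
Proof.
move=> /andP[x0 x1]; have x1' : 0 < 1 - x by rewrite subr_gt0.
rewrite /wJS !gtr0_norm// -!(@mulr_powRB1 _ _ (_ + 1)) ?addrK ?(ltW x0) ?(ltW
  x1')//; [by ring|by rewrite -ltrBlDr sub0r|by rewrite -ltrBlDr sub0r].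
Qed.

Let powR_le1 (x r : R) : 0 <= r -> 0 < x < 1 -> `|x| `^ r <= 1.
Proof.
move=> r0 /andP[x0 x1]; have <- : 1 `^ r = 1 :> R by rewrite powR1.
by apply: ge0_ler_powR; rewrite ?nnegrE// gtr0_norm// ltW.
Qed.

(** The values at [0] and [1] are [0] because [x - x^2] vanishes there. Near each endpoint [w0] is
    bounded by some [M], so the function is dominated by [M] times a positive power of the distance
    to that endpoint. *)
Lemma continuous_q_wJS :
  {within `[0, 1], continuous (fun x : R => (x - x ^+ 2) * wJ x)}.
Proof.
have [_ _ _ bd0 bd1] := hw0.
have a1 : 0 < alpha + 1 by rewrite -ltrBlDr sub0r.
have b1 : 0 < beta + 1 by rewrite -ltrBlDr sub0r.
apply/continuous_within_itvP; first exact: ltr01.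
split.
- move=> x; rewrite in_itv /= => x01.
  apply: cvgM.
    by apply: cvgB; [exact: cvg_id|exact: exprn_continuous].
  by apply/differentiable_continuous/derivable1_diffP; apply: ex_derive;
    exact: is_derive_wJS.
- rewrite expr0n/= subrr mul0r; have [M M0 hM] := bounded_near_bound bd0.
  apply: (@cvg0_dominated _ _ _ (fun x => `|x| `^ (alpha + 1)) M); last first.
    apply: cvg_at_right_filter; have := continuous_norm_powR a1 (x := 0).
    by rewrite /continuous_at normr0 powR0 ?gt_eqF.
  near=> x; have x01 : 0 < x < 1.
    by apply/andP; split; near: x; [exact: nbhs_right_gt|exact: nbhs_right_lt].
  rewrite q_wJSE// !normrM !(ger0_norm (powR_ge0 _ _)) mulrC ler_pM ?mulr_ge0
    ?powR_ge0//.
    by near: x.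
  rewrite ler_piMr ?powR_ge0// powR_le1 ?ltW// subr_gt0.
  by move: x01 => /andP[x0 x1]; rewrite x1 ltrBlDr ltrDl x0.
- rewrite expr1n subrr mul0r; have [M M0 hM] := bounded_near_bound bd1.
  apply: (@cvg0_dominated _ _ _ (fun x => `|1 - x| `^ (beta + 1)) M); last first.
    apply: cvg_at_left_filter.
    have c1 : {for 1, continuous (fun x : R => 1 - x)}.
      by apply: cvgB; [exact: cvg_cst|exact: cvg_id].
    have := continuous_comp c1 (@continuous_norm_powR _ b1 (1 - 1)).
    by rewrite /prop_for /continuous_at /= subrr normr0 powR0 ?gt_eqF.
  near=> x; have x01 : 0 < x < 1.
    by apply/andP; split; near: x; [exact: nbhs_left_gt|exact: nbhs_left_lt].
  rewrite q_wJSE// !normrM !(ger0_norm (powR_ge0 _ _)) mulrC ler_pM ?mulr_ge0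
    ?powR_ge0//.
    by near: x.
  by rewrite ler_piMl ?powR_ge0// powR_le1// ltW.
Unshelve. all: by end_near. Qed.

Variables (t gamma A B : R).
Hypothesis hgamma : 0 < gamma.
Local Notation wt := (weight alpha beta w0 t gamma A B).

Let psi (x : R) := `|x - t| `^ gamma * (A + B * theta (x - t)).

Let weightE (x : R) : wt x = wJ x * psi x.
Proof. by rewrite /weight /psi mulrA. Qed.

(** The sign [s] of [x - t] treats both sides of [t] at once: near [x] the absolute value is linear
    and [theta] is constant. *)
Let same_side (x : R) : x != t -> exists s : R, [/\ s * s = 1, 0 < s * (x - t) &
  \forall y \near x, `|y - t| = s * (y - t) /\ theta (y - t) = theta (x - t)].
Proof.
rewrite neq_lt => /orP[xt|tx].
  exists (-1); split; [by ring|by rewrite mulN1r oppr_gt0 subr_lt0|near=> y].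
  have yt : y < t by near: y; exact: lt_nbhsl.
  by rewrite mulN1r ltr0_norm ?subr_lt0// /theta !subr_gt0 !ltNge !ltW.
exists 1; split; [by ring|by rewrite mul1r subr_gt0|near=> y].
have ty : t < y by near: y; exact: lt_nbhsr.
by rewrite mul1r gtr0_norm ?subr_gt0// /theta !subr_gt0 ty tx.
Unshelve. all: by end_near. Qed.

Let is_derive_psi (x : R) : x != t -> is_derive x 1 psi (gamma / (x - t) * psi x).
Proof.
move=> xt; have [s [ss s0 near_s]] := same_side xt.
have [sx _] : `|x - t| = s * (x - t) /\ theta (x - t) = theta (x - t).
  exact: nbhs_singleton near_s.
pose c := A + B * theta (x - t).
apply: (@near_eq_is_derive _ _ _ (fun y => c * (s * (y - t)) `^ gamma)).
  near=> y; have [yE tE] : `|y - t| = s * (y - t) /\ theta (y - t) = theta (x - t).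
    by near: y.
  by rewrite /psi yE tE mulrC.
have d1 : is_derive x 1 (fun y => y - t) (1 - 0) by exact: is_deriveB.
have d2 : is_derive x 1 (fun y => s * (y - t)) (s *: (1 - 0)) := is_deriveZ s d1.
have d3 := @is_derive1_comp R (fun y => y `^ gamma) (fun y => s * (y - t)) x _ _
  (is_derive1_powR gamma s0) d2.
apply: (is_derive_eq (is_deriveZ c d3)).
rewrite /psi sx -/c -(mulr_powRB1 (ltW s0) hgamma) /GRing.scale /=.
have xt0 : x - t != 0 by rewrite subr_eq0.
rewrite subr0 mulr1 -[LHS]mulr1 -[in LHS]ss.
have -> : gamma / (x - t) * (s * (x - t) * (s * (x - t)) `^ (gamma - 1) * c) =
  gamma * (s * (s * (x - t)) `^ (gamma - 1) * c) by field.
rewrite ss; ring.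
Unshelve. all: by end_near. Qed.

Lemma is_derive_weight (x : R) : 0 < x < 1 -> x != t ->
  is_derive x 1 wt ((- derive1 vJ x + gamma / (x - t)) * wt x).
Proof.
move=> x01 xt; have -> : wt = (fun y => wJ y * psi y) by apply/funext => y;
  exact: weightE.
apply: (is_derive_eq (is_deriveM (is_derive_wJS x01) (is_derive_psi xt))).
by rewrite /GRing.scale /=; ring.
Qed.

Let continuous_psi : continuous psi.
Proof. exact: continuous_jump_factor. Qed.

Lemma continuous_q_weight :
  {within `[0, 1], continuous (fun x : R => (x - x ^+ 2) * wt x)}.
Proof.
have -> : (fun x : R => (x - x ^+ 2) * wt x) =
    (fun x => (x - x ^+ 2) * wJ x * psi x).
  by apply/funext => x; rewrite weightE mulrA.
move=> x; apply: cvgM; first exact: continuous_q_wJS.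
exact: continuous_subspaceT.
Qed.

(** All factors other than [wJ] form a continuous function, bounded on [[0, 1]], and [wJ] is
    integrable by its zeroth moment. *)
Lemma integrable_poly_weight (p : {poly R}) : finite_moments wJ ->
  mu.-integrable `]0, 1[ (EFin \o (fun x => p.[x] * wt x)).
Proof.
move=> /(_ 0) wJi; pose k x := p.[x] * psi x.
have ck : continuous k by move=> x; apply: cvgM;
  [exact: continuous_horner|exact: continuous_psi].
have -> : (EFin \o (fun x => p.[x] * wt x)) =
    ((EFin \o k) \* (fun x => (x ^+ 0 * wJ x)%:E))%E.
  by apply/funext => x /=; rewrite weightE -EFinM /k; congr EFin; ring.
apply: integrableMr => //.
  by apply: measurable_funTS; exact: continuous_measurable_fun.
have : bounded_set (k @` `[0, 1]).
  apply: compact_bounded; apply: continuous_compact; last exact: segment_compact.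
  exact: continuous_subspaceT.
move=> [M [Mr hM]]; exists M; split => // N /hM hN x /= x01.
by apply: hN; exists x => //; exact: subset_itv_oo_cc x01.
Qed.

End WeightAnalysis.

(** * Integration by parts against the weight, and positivity of its moment form *)

Lemma finite_poly_roots (F : fieldType) (p : {poly F}) : p != 0 ->
  finite_set [set x | root p x].
Proof.
have [n] := ubnP (size p); elim: n p => // n IH p; rewrite ltnS => sp p0.
have [[a ra]|nr] := pselect (exists a, root p a); last first.
  rewrite (_ : [set x | root p x] = set0); first exact: finite_set0.
  by apply/seteqP; split => // x rx; apply: nr; exists x.
have [r pE] := factor_theorem p a ra.
have r0 : r != 0 by apply: contraNneq p0 => r0; rewrite pE r0 mul0r.
have sr : (size r < n)%N.
  by rewrite (leq_trans _ sp)// pE size_Mmonic ?monicXsubC// size_XsubC addn2.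
apply: (@sub_finite_set _ _ ([set a] `|` [set x | root r x])); last first.
  by rewrite finite_setU; split; [exact: finite_set1|exact: IH].
by move=> x /=; rewrite pE rootM root_XsubC => /orP[rx|/eqP xa]; [right|left].
Qed.

Section ByParts.
Context {R : realType}.
Local Notation mu := (@lebesgue_measure R).
Variables (alpha beta : R) (w0 : R -> R).
Hypotheses (halpha : -1 < alpha) (hbeta : -1 < beta) (hw0 : admissible_w0 w0).
Hypothesis hmom : finite_moments (wJS alpha beta w0).
Variables (t gamma A B : R).
Hypothesis hgamma : 0 < gamma.
Local Notation wt := (weight alpha beta w0 t gamma A B).
Local Notation dv := (derive1 (vJS alpha beta w0)).

Definition moment_form (wt : R -> R) (p : {poly R}) : R :=
  \int[mu]_(x in `]0, 1[) (p.[x] * wt x).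
Local Notation ell := (moment_form wt).

Lemma moment_form_linear (a : R) (p q : {poly R}) :
  ell (a *: p + q) = a * ell p + ell q.
Proof.
have pi := integrable_poly_weight t A B hgamma p hmom.
have qi := integrable_poly_weight t A B hgamma q hmom.
rewrite /moment_form -RintegralZl// -RintegralD//; last first.
  rewrite (_ : (fun x => a * _) = (fun x => (a *: p).[x] * wt x)).
    exact: integrable_poly_weight.
  by apply/funext => x; rewrite hornerZ mulrA.
by apply: eq_Rintegral => x _; rewrite hornerD hornerZ; ring.
Qed.

(** Off [S] the function [g] is [p w + (Q w)'] with [Q = (X - X^2) U] and [p = T - Q']. So [G] minus
    a primitive of [p w] minus [Q w] is continuous and locally constant off [S], hence has equal end
    values; the boundary terms vanish with [Q] at [0] and [1]. *)
Lemma primitive_by_parts (S : seq R) (g G : R -> R) (T U : {poly R}) :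
  primitive_off S 0 1 g G -> t \in S ->
  (forall x, 0 < x < 1 -> x \notin S ->
    g x = T.[x] * wt x
          + (x - x ^+ 2) * U.[x] * ((- dv x + gamma / (x - t)) * wt x)) ->
  G 1 - G 0 = ell (T - (('X - 'X^2) * U)^`()).
Proof.
move=> [cG GP] tS gE.
pose Q : {poly R} := ('X - 'X^2) * U; pose p := T - Q^`().
have QE x : Q.[x] = (x - x ^+ 2) * U.[x] by rewrite /Q !hornerE.
(* Cutting off outside []0, 1[] makes the integrand [0] at the endpoints, so its primitive [H] can
   be taken on the closed interval. *)
pose k : R -> R := (fun x => p.[x] * wt x) \_ (`]0, 1[ : set R).
have pi := integrable_poly_weight t A B hgamma p hmom.
have ki : mu.-integrable `[0, 1] (EFin \o k).
  by rewrite -restrict_EFin; apply/integrable_restrict => //=;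
    rewrite setIidr//; exact: subset_itv_oo_cc.
pose H x := \int[mu]_(y in `[0, x]) k y.
have cH : {within `[0, 1], continuous H} :=
  parameterized_integral_continuous ler01 ki.
have cW : {within `[0, 1], continuous (fun x => Q.[x] * wt x)}.
  rewrite (_ : (fun x => _) = (fun x => (x - x ^+ 2) * wt x * U.[x])); last first.
    by apply/funext => x; rewrite QE; ring.
  move=> x; apply: cvgM; first exact: continuous_q_weight.
  by apply: continuous_subspaceT; exact: continuous_horner.
pose Phi x := G x - H x - Q.[x] * wt x.
have Phi01 : Phi 0 = Phi 1.
  apply: (@eq_ends_of_locally_cst _ S) ltr01 _ _.
    by apply: within_continuousB => //; exact: within_continuousB.
  move=> c d c0; rewrite le_eqVlt => /predU1P[<-//|cd] d1 nS.
  have [gi gG] := GP c d c0 (ltW cd) d1 nS.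
  have in01 x : c <= x <= d -> 0 < x < 1.
    by move=> /andP[cx xd]; rewrite (lt_le_trans c0)// (le_lt_trans xd).
  have nxt x : c <= x <= d -> x != t.
    by apply: contraTneq => ->; exact: nS.
  have pHd : H d - H c = \int[mu]_(x in `[c, d]) (p.[x] * wt x).
    have cd0 : mu.-integrable `[0, d] (EFin \o k).
      by apply: integrableS ki => //; apply: subset_itvl; rewrite bnd_simp ltW.
    rewrite /H (@Rintegral_itv_chasles _ _ 0 c d) ?ltW// addrC addKr.
    apply: eq_Rintegral => x; rewrite inE /= in_itv /= => xcd.
    by rewrite /k patchE mem_set//= in_itv/=; exact: in01.
  have pcd : mu.-integrable `[c, d] (EFin \o (fun x => p.[x] * wt x)).
    by apply: integrableS pi => //; apply: subset_itv; rewrite bnd_simp.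
  pose f x := Q^`().[x] * wt x + Q.[x] * ((- dv x + gamma / (x - t)) * wt x).
  have dW x : c <= x <= d -> is_derive x 1 (fun x => Q.[x] * wt x) (f x).
    move=> xcd.
    have dw := is_derive_weight alpha beta hw0 A B hgamma (in01 _ xcd) (nxt _ xcd).
    apply: (is_derive_eq (is_deriveM (is_derive_poly Q x) dw)).
    by rewrite /GRing.scale /= /f; ring.
  have cf : {within `[c, d], continuous f}.
    apply: continuous_in_subspaceT => x; rewrite inE /= in_itv/= => xcd.
    have cw : {for x, continuous wt}.
      apply/differentiable_continuous/derivable1_diffP.
      by case: (is_derive_weight alpha beta hw0 A B hgamma (in01 _ xcd) (nxt _
        xcd)).
    apply: cvgD; apply: cvgM;
      [exact: continuous_horner|exact: cw|exact: continuous_horner|].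
    apply: cvgM; last exact: cw.
    apply: cvgD; first by apply: cvgN; exact: continuous_derive1_vJS (in01 _ xcd).
    apply: cvgM; first exact: cvg_cst.
    apply: cvgV; first by rewrite subr_eq0 nxt.
    by apply: cvgB; [exact: cvg_id|exact: cvg_cst].
  have fW : \int[mu]_(x in `[c, d]) f x = Q.[d] * wt d - Q.[c] * wt c.
    rewrite /Rintegral (@continuous_FTC2 _ f (fun x => Q.[x] * wt x))//.
      have cWx x : c <= x <= d -> {for x, continuous (fun x => Q.[x] * wt x)}.
        move=> /dW[dWx _]; exact/differentiable_continuous/derivable1_diffP.
      split.
      - by move=> x; rewrite in_itv/= => /andP[cx xd]; case: (dW x) => //;
        rewrite !ltW.
      - by apply: cvg_at_right_filter; apply: cWx; rewrite lexx ltW.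
      - by apply: cvg_at_left_filter; apply: cWx; rewrite lexx ltW.
    move=> x; rewrite in_itv/= => /andP[cx xd]; rewrite derive1E.
    have xcd : c <= x <= d by rewrite !ltW.
    exact: (@derive_val _ _ _ _ _ _ _ (dW _ xcd)).
  have fi : mu.-integrable `[c, d] (EFin \o f).
    by apply: continuous_compact_integrable => //; exact: segment_compact.
  have : \int[mu]_(x in `[c, d]) g x =
      \int[mu]_(x in `[c, d]) (p.[x] * wt x) + \int[mu]_(x in `[c, d]) f x.
    rewrite -RintegralD//; apply: eq_Rintegral => x;
      rewrite inE /= in_itv /= => xcd.
    rewrite gE ?in01//; last by apply: contraTN xcd; exact: nS.
    by rewrite /f /p hornerD hornerN QE; ring.
  rewrite gG -pHd fW /Phi => E; apply/eqP; rewrite -subr_eq0; apply/eqP.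
  transitivity (H d - H c + (Q.[d] * wt d - Q.[c] * wt c) - (G d - G c));
    first by ring.
  by rewrite E subrr.
have H0 : H 0 = 0 by rewrite /H set_itv1 Rintegral_set1.
have H1 : H 1 = ell p.
  rewrite /H /k -Rintegral_mkcondr setIidr//; exact: subset_itv_oo_cc.
move: Phi01; rewrite /Phi H0 H1 !QE expr0n expr1n /= !subrr !mul0r !subr0 => ->.
exact: subKr.
Qed.

(** If the integral were zero, [p^2 w] would vanish almost everywhere, so the set where [w > 0]
    would lie in a null set together with the finitely many roots of [p]. *)
Lemma moment_form_sqr_gt0 (p : {poly R}) :
  (forall x : R, 0 < x < 1 -> 0 <= wt x) ->
  (0 < mu [set x | (0 < x < 1)%R /\ (0 < wt x)%R])%E ->
  p != 0 -> 0 < ell (p * p).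
Proof.
move=> w_ge0 w_pos p0.
have pi := integrable_poly_weight t A B hgamma (p * p) hmom.
have f0 x : 0 < x < 1 -> 0 <= (p * p).[x] * wt x.
  by move=> x01; rewrite mulr_ge0 ?w_ge0// hornerM -expr2 sqr_ge0.
rewrite lt_neqAle Rintegral_ge0 ?andbT; last by move=> x /=; rewrite in_itv/=;
  exact: f0.
apply: contraTneq w_pos => I0.
pose E : set R := [set x | (0 < x < 1)%R /\ (0 < wt x)%R].
have mE : measurable E.
  have := measurable_int _ (integrable_poly_weight t A B hgamma 1 hmom).
  move=> /measurable_EFinP /(_ (measurable_itv _)) /(_ _ (measurable_itv `]0,
    +oo[)).
  congr measurable; apply/seteqP; split => x /=;
    rewrite !in_itv/= hornerC mul1r andbT; by case.
have ae0 : ae_eq mu (`]0, 1[%classic : set R) (EFin \o (fun x => (p * p).[x] *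
  wt x)) (cst 0%E).
  apply/ae_eq_integral_abs => //; first exact: measurable_int pi.
  transitivity (ell (p * p))%:E; last by rewrite -I0.
  rewrite /moment_form /Rintegral fineK ?integrable_fin_num//.
  by apply: eq_integral => x; rewrite inE/= in_itv/= => x01; rewrite ger0_norm// f0.
have NE : mu.-negligible E.
  apply: (@negligibleS _ _ _ mu (~` [set x : R | `]0,
    1[%classic x -> ((p * p).[x] * wt x)%:E = 0%E] `|` [set x | root p x]) _).
    move=> x [x01 wx]; have [rx|nrx] := boolP (root p x); [by right|left] => /=.
    rewrite in_itv/= => /(_ x01) /eqP; rewrite eqe mulf_eq0 (gt_eqF wx) orbF
      hornerM mulf_eq0 orbb.
    by apply/negP.
  apply: negligibleU; first exact: ae0.
  have cr := finite_set_countable (finite_poly_roots p0).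
  exists [set x | root p x]; split => //; last exact: countable_lebesgue_measure0.
  exact: countable_measurable.
have -> : mu [set x | (0 < x < 1)%R /\ (0 < wt x)%R] = 0%E by exact:
  measure_negligible NE.
by rewrite ltxx.
Qed.

End ByParts.

(** * Passage from real to complex polynomials and integrals *)

Section ComplexForm.
Context {R : realType}.
Local Notation mu := (@lebesgue_measure R).
Local Notation C := R[i].
Local Notation cpoly := (map_poly (real_complex R)).

Definition re_poly (p : {poly C}) : {poly R} := map_poly (@complex.Re R) p.
Definition im_poly (p : {poly C}) : {poly R} := map_poly (@complex.Im R) p.

Let coef_re (p : {poly C}) k : (re_poly p)`_k = complex.Re p`_k.
Proof. exact: coef_map_id0. Qed.
Let coef_im (p : {poly C}) k : (im_poly p)`_k = complex.Im p`_k.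
Proof. exact: coef_map_id0. Qed.
Let coefC (p : {poly R}) k : (cpoly p)`_k = (p`_k)%:C.
Proof. exact: coef_map. Qed.
Let hornerC (p : {poly R}) x : (cpoly p).[x%:C] = (p.[x])%:C.
Proof. exact: horner_map. Qed.

Lemma ReM (x y : C) : complex.Re (x * y) =
  complex.Re x * complex.Re y - complex.Im x * complex.Im y.
Proof. by case: x y => [? ?] [? ?]. Qed.
Lemma ImM (x y : C) : complex.Im (x * y) =
  complex.Re x * complex.Im y + complex.Im x * complex.Re y.
Proof. by case: x y => [? ?] [? ?]. Qed.
Lemma ReD (x y : C) : complex.Re (x + y) = complex.Re x + complex.Re y.
Proof. by case: x y => [? ?] [? ?]. Qed.
Lemma ImD (x y : C) : complex.Im (x + y) = complex.Im x + complex.Im y.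
Proof. by case: x y => [? ?] [? ?]. Qed.

Lemma re_im_polyE (p : {poly C}) : p = cpoly (re_poly p) + 'i *: cpoly (im_poly p).
Proof.
apply/polyP => k; rewrite coefD coefZ !coefC coef_re coef_im.
exact: complexE.
Qed.

Lemma re_poly_comb (a b : {poly R}) : re_poly (cpoly a + 'i *: cpoly b) = a.
Proof.
apply/polyP => k; rewrite coef_re coefD coefZ !coefC ReD ReM /=; ring.
Qed.

Lemma im_poly_comb (a b : {poly R}) : im_poly (cpoly a + 'i *: cpoly b) = b.
Proof.
apply/polyP => k; rewrite coef_im coefD coefZ !coefC ImD ImM /=; ring.
Qed.

Let mul_realE (p : {poly R}) (f : {poly C}) :
  cpoly p * f = cpoly (p * re_poly f) + 'i *: cpoly (p * im_poly f).
Proof. by rewrite {1}[f]re_im_polyE mulrDr -scalerAr !rmorphM. Qed.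

Lemma re_poly_realM (p : {poly R}) (f : {poly C}) :
  re_poly (cpoly p * f) = p * re_poly f.
Proof. by rewrite mul_realE re_poly_comb. Qed.

Lemma im_poly_realM (p : {poly R}) (f : {poly C}) :
  im_poly (cpoly p * f) = p * im_poly f.
Proof. by rewrite mul_realE im_poly_comb. Qed.

Let derivE (p : {poly C}) :
  p^`() = cpoly (re_poly p)^`() + 'i *: cpoly (im_poly p)^`().
Proof. by rewrite {1}[p]re_im_polyE derivD derivZ !deriv_map. Qed.

Lemma re_poly_deriv (p : {poly C}) : re_poly p^`() = (re_poly p)^`().
Proof. by rewrite derivE re_poly_comb. Qed.

Lemma im_poly_deriv (p : {poly C}) : im_poly p^`() = (im_poly p)^`().
Proof. by rewrite derivE im_poly_comb. Qed.

Lemma re_polyB (p q : {poly C}) : re_poly (p - q) = re_poly p - re_poly q.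
Proof. by apply/polyP => k; rewrite coefB !coef_re coefB;
  case: (p`_k) (q`_k) => [? ?] [? ?]. Qed.

Lemma im_polyB (p q : {poly C}) : im_poly (p - q) = im_poly p - im_poly q.
Proof. by apply/polyP => k; rewrite coefB !coef_im coefB;
  case: (p`_k) (q`_k) => [? ?] [? ?]. Qed.

Lemma Re_horner (p : {poly C}) (x : R) : complex.Re p.[x%:C] = (re_poly p).[x].
Proof.
rewrite {1}[p]re_im_polyE hornerD hornerZ !hornerC ReD ReM /=; ring.
Qed.

Lemma Im_horner (p : {poly C}) (x : R) : complex.Im p.[x%:C] = (im_poly p).[x].
Proof.
rewrite {1}[p]re_im_polyE hornerD hornerZ !hornerC ImD ImM /=; ring.
Qed.

(** The complex-linear extension of the moment form, built from coefficientwise parts so that only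
    real integrals occur. *)
Definition cmoment_form (wt : R -> R) (p : {poly C}) : C :=
  Complex (moment_form wt (re_poly p)) (moment_form wt (im_poly p)).

Lemma cmoment_form_linear (wt : R -> R) :
  (forall (a : R) p q,
     moment_form wt (a *: p + q) = a * moment_form wt p + moment_form wt q) ->
  forall (a : C) p q,
    cmoment_form wt (a *: p + q) = a * cmoment_form wt p + cmoment_form wt q.
Proof.
move=> ell a p q; apply/eqP; rewrite eq_complex ReD ImD ReM ImM /=; apply/andP;
  split; apply/eqP.
  have -> : re_poly (a *: p + q) =
      complex.Re a *: re_poly p + (- complex.Im a *: im_poly p + re_poly q).
    apply/polyP => k; rewrite !(coefD, coefZ, coef_re, coef_im) ReD ReM; ring.
  by rewrite !ell; ring.
have -> : im_poly (a *: p + q) =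
    complex.Re a *: im_poly p + (complex.Im a *: re_poly p + im_poly q).
  apply/polyP => k; rewrite !(coefD, coefZ, coef_re, coef_im) ImD ImM; ring.
by rewrite !ell; ring.
Qed.

(** A real factor commutes with taking parts, and the parts of [f] are no longer than [f]; real
    orthogonality therefore passes to complex test polynomials. *)
Lemma cmoment_form_realM (wt : R -> R) (p : {poly R}) (f : {poly C}) :
  (forall g : {poly R}, (size g <= size f)%N -> moment_form wt (p * g) = 0) ->
  cmoment_form wt (cpoly p * f) = 0.
Proof.
move=> op; rewrite /cmoment_form re_poly_realM im_poly_realM !op//.
  exact: size_poly.
exact: size_poly.
Qed.

Lemma cmoment_form_real (wt : R -> R) (p : {poly R}) : moment_form wt 0 = 0 ->
  cmoment_form wt (cpoly p) = (moment_form wt p)%:C.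
Proof.
move=> ell0; have pE : cpoly p = cpoly p + 'i *: cpoly 0.
  by rewrite rmorph0 scaler0 addr0.
by rewrite /cmoment_form pE re_poly_comb im_poly_comb ell0.
Qed.

Lemma primitive_off_comb (S1 S2 : seq R) (f g F G : R -> R) (a b x y : R) :
  primitive_off S1 x y f F -> primitive_off S2 x y g G ->
  primitive_off (S1 ++ S2) x y
    (fun u => a * f u + b * g u) (fun u => a * F u + b * G u).
Proof.
move=> [cF FP] [cG GP]; split.
  by move=> u; apply: cvgD; apply: cvgM; try exact: cvg_cst; [exact: cF|exact: cG].
move=> c d xc cd dy nS.
have [fi fF] : mu.-integrable `[c, d] (EFin \o f) /\
    \int[mu]_(u in `[c, d]) f u = F d - F c.
  by apply: FP => // s sS; apply: nS; rewrite mem_cat sS.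
have [gi gG] : mu.-integrable `[c, d] (EFin \o g) /\
    \int[mu]_(u in `[c, d]) g u = G d - G c.
  by apply: GP => // s sS; apply: nS; rewrite mem_cat sS orbT.
have afi : mu.-integrable `[c, d] (EFin \o (fun u => a * f u)).
  rewrite (_ : EFin \o _ = (fun u => a%:E * (EFin \o f) u)%E);
    last by apply/funext => u; rewrite /= EFinM.
  exact: integrableZl.
have bgi : mu.-integrable `[c, d] (EFin \o (fun u => b * g u)).
  rewrite (_ : EFin \o _ = (fun u => b%:E * (EFin \o g) u)%E);
    last by apply/funext => u; rewrite /= EFinM.
  exact: integrableZl.
split.
  rewrite (_ : EFin \o _ = ((EFin \o (fun u => (a * f u)%R)) \+ (EFin \o (fun u =>
    (b * g u)%R)))%E); last by apply/funext => u; rewrite /= EFinD.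
  exact: integrableD.
by rewrite RintegralD// !RintegralZl// fF gG; ring.
Qed.

(** Stands in for the improper integral: unlike the splitting at chosen points, it is directly
    closed under complex linear combinations. One list [S] serves both parts. *)
Definition cprimitive01 (f : R -> C) (l : C) : Prop :=
  exists S Fr Fi, [/\ primitive_off S 0 1 (fun x => complex.Re (f x)) Fr,
    primitive_off S 0 1 (fun x => complex.Im (f x)) Fi
  & l = Complex (Fr 1 - Fr 0) (Fi 1 - Fi 0)].

Lemma primitive_offS (S1 S2 : seq R) (f F : R -> R) (x y : R) :
  {subset S1 <= S2} -> primitive_off S1 x y f F -> primitive_off S2 x y f F.
Proof.
by move=> S12 [cF FP]; split => // c d xc cd dy nS; apply: FP => // s /S12;
  exact: nS.
Qed.

Lemma cprimitive01_of_cvg (f : R -> C) : ccvg01 f -> cprimitive01 f (cint01 f).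
Proof.
move=> f_cvg; have [] : is_cint01 f (cint01 f).
  exact: (@xgetPex _ 0 [set l | is_cint01 f l] f_cvg).
move=> /primitive_of_improper[_ [S1 [F1 [P1 l1]]]].
move=> /primitive_of_improper[_ [S2 [F2 [P2 l2]]]].
exists (S1 ++ S2), F1, F2; split.
- by apply: primitive_offS P1 => s sS; rewrite mem_cat sS.
- by apply: primitive_offS P2 => s sS; rewrite mem_cat sS orbT.
- by rewrite -l1 -l2; case: (cint01 f).
Qed.

Lemma cprimitive01_comb (f g : R -> C) (k l a b : C) :
  cprimitive01 f k -> cprimitive01 g l ->
  cprimitive01 (fun x => a * f x + b * g x) (a * k + b * l).
Proof.
move=> [S1 [Fr [Fi [Pr Pi ->]]]] [S2 [Gr [Gi [Qr Qi ->]]]].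
pose ar := complex.Re a; pose ai := complex.Im a; pose br := complex.Re b;
  pose bi := complex.Im b.
(* These are the real and imaginary parts of [a f + b g]. Both constructions concatenate the lists
   in the same order, so they share one exceptional list. *)
have H1 := primitive_off_comb 1 1 (primitive_off_comb ar (- ai) Pr Pi)
  (primitive_off_comb br (- bi) Qr Qi).
have H2 := primitive_off_comb 1 1 (primitive_off_comb ar ai Pi Pr)
  (primitive_off_comb br bi Qi Qr).
do 3 eexists; split.
- set h := (h in primitive_off _ _ _ h _) in H1.
  rewrite (_ : (fun x => _) = h); last by apply/funext => x;
    rewrite /h /= ReD !ReM; ring.
  exact: H1.
- set h := (h in primitive_off _ _ _ h _) in H2.
  rewrite (_ : (fun x => _) = h); last by apply/funext => x;
    rewrite /h /= ImD !ImM; ring.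
  exact: H2.
- by apply/eqP; rewrite eq_complex ReD ImD !ReM !ImM /= -/ar -/ai -/br -/bi;
  apply/andP; split; apply/eqP; ring.
Qed.

End ComplexForm.

(** * The kernel identity for the orthogonal polynomials and the two ladder relations *)

Section Ladder.
Context {R : realType}.
Local Notation mu := (@lebesgue_measure R).
Local Notation C := R[i].
Local Notation cpoly := (map_poly (real_complex R)).
Variables (alpha beta : R) (w0 : R -> R).
Hypotheses (halpha : -1 < alpha) (hbeta : -1 < beta) (hw0 : admissible_w0 w0).
Hypothesis hmom : finite_moments (wJS alpha beta w0).
Variables (t gamma A B : R).
Hypothesis hgamma : 0 < gamma.
Local Notation wt := (weight alpha beta w0 t gamma A B).
Local Notation v := (vJS alpha beta w0).
Local Notation L := (cmoment_form wt).

Lemma cprimitive01_by_parts (g : R -> C) (l z : C) (T U : {poly C}) :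
  cprimitive01 g l ->
  (forall x : R, 0 < x < 1 -> x != t -> z != x%:C ->
    g x = T.[x%:C] * (wt x)%:C + (x - x ^+ 2)%:C * U.[x%:C] *
          ((- derive1 v x + gamma / (x - t)) * wt x)%:C) ->
  l = L (T - (('X - 'X^2) * U)^`()).
Proof.
move=> [S [Fr [Fi [Pr Pi ->]]]] gE.
(* The point [t] is excluded because the weight is differentiated only away from it, and [Re z]
   because a real [z] is a pole of the kernels. *)
pose S' := [:: t, complex.Re z & S].
have S'P x : x \notin S' -> x != t /\ z != x%:C.
  rewrite !inE !negb_or => /and3P[xt xz _]; split => //.
  by apply: contraNneq xz => ->.
have sS : {subset S <= S'} by move=> s sS; rewrite !inE sS !orbT.
have tS' : t \in S' by rewrite inE eqxx.
have qE : 'X - 'X^2 = cpoly ('X - 'X^2) :> {poly C}.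
  by rewrite rmorphB /= map_polyX map_polyXn.
rewrite /cmoment_form re_polyB im_polyB re_poly_deriv im_poly_deriv qE
  re_poly_realM im_poly_realM.
congr Complex.
  apply: (primitive_by_parts halpha hbeta hw0 hmom hgamma
    (primitive_offS sS Pr) tS').
  move=> x x01 /S'P[xt xz]; rewrite gE// -!Re_horner ReD !ReM /=; ring.
apply: (primitive_by_parts halpha hbeta hw0 hmom hgamma (primitive_offS sS Pi) tS').
move=> x x01 /S'P[xt xz]; rewrite gE// -!Im_horner ImD !(ImM, ReM) /=; ring.
Qed.

(* The Christoffel-Darboux kernel [D] absorbs the denominator [z - x]; what is
   left of the two kernels is [v'(z)] plus the logarithmic derivative of the
   weight. *)
Lemma kernel_integrals (a b y : {poly R}) (D : {poly C}) (z dvz k1 k2 k3 k4 : C) :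
  (z%:P - 'X) * D = (cpoly b).[z] *: cpoly a - (cpoly a).[z] *: cpoly b ->
  cprimitive01 (fun x => v_kernel v z dvz x * (a.[x] * y.[x] * wt x)%:C) k1 ->
  cprimitive01 (fun x => v_kernel v z dvz x * (b.[x] * y.[x] * wt x)%:C) k2 ->
  cprimitive01 (fun x => t_kernel t z x * (a.[x] * y.[x] * wt x)%:C) k3 ->
  cprimitive01 (fun x => t_kernel t z x * (b.[x] * y.[x] * wt x)%:C) k4 ->
  (cpoly b).[z] * k1 - (cpoly a).[z] * k2
  + gamma%:C * ((cpoly b).[z] * k3 - (cpoly a).[z] * k4) =
  L (((z - z ^+ 2) * dvz) *: (cpoly y * D) - (('X - 'X^2) * (cpoly y * D))^`()).
Proof.
set az := (cpoly a).[z]; set bz := (cpoly b).[z] => defD c1 c2 c3 c4.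
have c12 := cprimitive01_comb bz (- az) c1 c2.
have c34 := cprimitive01_comb (gamma%:C * bz) (- (gamma%:C * az)) c3 c4.
have c := cprimitive01_comb 1 1 c12 c34.
rewrite -(cprimitive01_by_parts (z := z) c); first by ring.
move=> x x01 xt zx; rewrite /v_kernel /t_kernel hornerZ hornerM.
have zx0 : z - x%:C != 0 by rewrite subr_eq0.
have xt0 : x%:C - t%:C != 0 by rewrite subr_eq0 (inj_eq (@complexI _)).
have Dx : D.[x%:C] = (bz * (a.[x])%:C - az * (b.[x])%:C) / (z - x%:C).
  apply: (mulfI zx0); have := congr1 (fun p => p.[x%:C]) defD.
  by rewrite !(hornerM, hornerD, hornerN, hornerC, hornerX,
    hornerZ) !horner_map /= => ->; rewrite [RHS]mulrC divfK.
have yx : (cpoly y).[x%:C] = (y.[x])%:C by exact: horner_map.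
rewrite Dx yx.
move: (derive1 v x) (wt x) => d w.
rewrite !(rmorphM, rmorphD, rmorphB, rmorphN, rmorphXn, fmorphV) /=.
by field; rewrite ?zx0 ?xt0.
Qed.

Variables (P : nat -> {poly R}) (h : nat -> R).
Hypothesis hP : monic_OPs wt P h.
Hypothesis hw_ge0 : forall x : R, 0 < x < 1 -> 0 <= wt x.
Hypothesis hw_pos : (0 < mu [set x | (0 < x < 1)%R /\ (0 < wt x)%R])%E.

Let ell_linear (k : R) (p q : {poly R}) :
  moment_form wt (k *: p + q) = k * moment_form wt p + moment_form wt q.
Proof. exact: moment_form_linear. Qed.

Let ell0 : moment_form wt 0 = 0.
Proof.
have := ell_linear (-1) 0 0; rewrite scaler0 addr0 mulN1r addNr; exact.
Qed.

Let ellPP i j : moment_form wt (P i * P j) = if i == j then h j else 0.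
Proof.
have [_ <-] := hP; apply: eq_Rintegral => x _.
by rewrite hornerM.
Qed.

Lemma OP_norm_neq0 j : h j != 0.
Proof.
have := moment_form_sqr_gt0 hmom hgamma hw_ge0 hw_pos (p := P j).
by rewrite ellPP eqxx => /(_ _)/lt0r_neq0; apply; rewrite monic_neq0//;
  have [[]] := hP.1 j.
Qed.

(** Induction on a degree bound [k <= i]: the top term of the test polynomial is removed by a
    multiple of [P k], which is orthogonal to [P i] since [k < i] at that stage. *)
Lemma OP_ortho i (f : {poly R}) : (size f <= i)%N -> moment_form wt (P i * f) = 0.
Proof.
suff H k : (k <= i)%N -> forall f : {poly R},
  (size f <= k)%N -> moment_form wt (P i * f) = 0.
  exact: H.
elim: k => [|k IH] ki g sg.
  by move: sg; rewrite leqn0 size_poly_eq0 => /eqP ->; rewrite mulr0 ell0.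
have [sP mP] := hP.1 k.
have Pk : (P k)`_k = 1 by move/monicP: mP; rewrite /lead_coef sP.
rewrite -[g](subrK (g`_k *: P k)) mulrDr addrC -scalerAr ell_linear ellPP.
rewrite gtn_eqF// mulr0 add0r IH ?(ltnW ki)//.
apply: size_sub_lead => //; last by rewrite coefZ Pk mulr1.
by rewrite (leq_trans (size_scale_leq _ _))// sP.
Qed.

Let size_P j : size (cpoly (P j)) = j.+1.
Proof. by rewrite size_map_poly; have [] := hP.1 j. Qed.
Let monic_P j : cpoly (P j) \is monic.
Proof. by rewrite map_monic; have [] := hP.1 j. Qed.
Let L_linear (k : C) p q : L (k *: p + q) = k * L p + L q.
Proof. by apply: cmoment_form_linear => a r s; exact: ell_linear. Qed.
Let L_linearB (k : C) p q : L (k *: p - q) = k * L p - L q.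
Proof.
have L0 : L 0 = 0.
  by have := L_linear (-1) 0 0; rewrite scaler0 addr0 mulN1r addNr.
by rewrite L_linear -scaleN1r -[-1 *: q]addr0 L_linear L0 addr0 mulN1r.
Qed.
Let ortho_P j (g : {poly C}) : (size g <= j)%N -> L (cpoly (P j) * g) = 0.
Proof.
by move=> sg; apply: cmoment_form_realM => f sf; apply: OP_ortho;
  exact: leq_trans sg.
Qed.
Let norm_P j : L (cpoly (P j) * cpoly (P j)) = (h j)%:C.
Proof. by rewrite -rmorphM cmoment_form_real ?ell0// ellPP eqxx. Qed.

Variables (m : nat) (z dvz : C).
Hypotheses (hz0 : z != 0) (hz1 : z != 1).
Local Notation p := (cpoly (P m)).
Local Notation q := (cpoly (P m.+1)).

(** The right-hand side vanishes at [z], so the factor theorem applies. *)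
Let exists_kernel : exists D, (z%:P - 'X) * D = p.[z] *: q - q.[z] *: p.
Proof.
have /factor_theorem[r rE] : root (p.[z] *: q - q.[z] *: p) z.
  by rewrite /root !hornerE mulrC subrr.
by exists (- r); rewrite rE -mulrNN opprK mulrC opprB.
Qed.

Let hz1' : 1 - z != 0.
Proof. by rewrite subr_eq0 eq_sym. Qed.

Let hC0 j : (h j)%:C != 0.
Proof. by rewrite -(rmorph0 (real_complex R)) (inj_eq (@complexI _))
  OP_norm_neq0. Qed.

Local Notation An := (A_coef v wt t gamma P h z dvz).
Local Notation Bn := (B_coef v wt t gamma P h z dvz).

(** The kernel identity with [y = P_(m+1)]: the term with [v'(z)] vanishes because [D] has degree at
    most [m], and [kernel_deriv_Q] evaluates the rest. *)
Lemma lowering_relation : A_cvg v wt t P z dvz m.+1 -> B_cvg v wt t P z dvz m.+1 ->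
  q^`().[z] = - Bn m.+1 * q.[z] + (h m.+1 / h m)%:C * An m.+1 * p.[z].
Proof.
move=> [/cprimitive01_of_cvg c1 /cprimitive01_of_cvg c3].
move=> [/cprimitive01_of_cvg c2 /cprimitive01_of_cvg c4].
have [D defD] := exists_kernel.
have E := kernel_integrals defD c1 c2 c3 c4.
have sD := kernel_size (size_P m) (size_P m.+1) defD.
have K := kernel_deriv_Q L_linear (size_P m) (size_P m.+1) (monic_P m)
  (monic_P m.+1) (@ortho_P m) (@ortho_P m.+1) (norm_P m) (norm_P m.+1) defD.
rewrite L_linearB mulrA K ortho_P// coef_map /= in E.
rewrite /A_coef /B_coef /subcoef.
move: E (hC0 m) (hC0 m.+1) hz1'.
set k1 := cint01 _; set k2 := cint01 _; set k3 := cint01 _; set k4 := cint01 _.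
rewrite rmorphM fmorphV /=.
move: k1 k2 k3 k4 (h m)%:C (h m.+1)%:C ((P m.+1)`_m)%:C gamma%:C => k1 k2 k3 k4
  a b c g.
move: p.[z] q.[z] q^`().[z] => pz qz dqz E a0 b0 z1.
apply/eqP; rewrite -subr_eq0; move/eqP: E; rewrite -subr_eq0 => /eqP E.
(* The defect of the desired identity is [EL] divided by [- h_m z (1 - z)], so clearing denominators
   suffices. *)
set EL := (X in X = 0) in E.
apply/eqP; transitivity (- EL / (a * (z * (1 - z)))); last by rewrite E oppr0 mul0r.
by rewrite /EL; field; rewrite ?a0 ?b0 ?hz0 ?z1.
Qed.

(** The kernel identity with [y = P_m]: the reproducing property now turns the term with [v'(z)]
    into [- h_m P_m(z)] times its coefficient, the source of the summand [dvz]; [kernel_deriv_P]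
    evaluates the rest. *)
Lemma raising_relation : B_cvg v wt t P z dvz m.+1 -> A_cvg v wt t P z dvz m ->
  p^`().[z] = (Bn m.+1 + dvz) * p.[z] - An m * q.[z].
Proof.
have ppC : pp wt P m m.+1 = pp wt P m.+1 m.
  by apply/funext => x; rewrite /pp [X in (X * _)%:C]mulrC.
rewrite /B_cvg /= ppC.
move=> [/cprimitive01_of_cvg c1 /cprimitive01_of_cvg c3].
move=> [/cprimitive01_of_cvg c2 /cprimitive01_of_cvg c4].
have [D defD] := exists_kernel.
have E := kernel_integrals defD c1 c2 c3 c4.
have K := kernel_deriv_P L_linear (size_P m) (size_P m.+1) (monic_P m)
  (monic_P m.+1) (@ortho_P m) (@ortho_P m.+1) (norm_P m) defD.
have LpD := kernel_reproducing L_linear (size_P m) (size_P m.+1) (monic_P m)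
  (monic_P m.+1) (@ortho_P m) (@ortho_P m.+1) (norm_P m) defD (f := p).
rewrite L_linearB mulrA K [p * D]mulrC LpD ?size_P// coef_map /= in E.
rewrite /A_coef.
move: E (hC0 m) hz1'.
set k1 := cint01 _; set k2 := cint01 _; set k3 := cint01 _; set k4 := cint01 _.
move: k1 k2 k3 k4 (h m)%:C ((P m.+1)`_m)%:C gamma%:C => k1 k2 k3 k4 a c g.
move: p.[z] q.[z] p^`().[z] => pz qz dpz E a0 z1.
apply/eqP; rewrite -subr_eq0; move/eqP: E; rewrite -subr_eq0 => /eqP E.
set EL := (X in X = 0) in E.
apply/eqP; transitivity (- EL / (a * (z * (1 - z)))); last by rewrite E oppr0 mul0r.
by rewrite /EL; field; rewrite ?a0 ?hz0 ?z1.
Qed.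

End Ladder.

Unset Implicit Arguments.

Theorem theorem5p4 (R : realType) (alpha beta : R) (w0 : R -> R)
    (halpha : -1 < alpha) (hbeta : -1 < beta)
    (hw0 : admissible_w0 w0)
    (hmom : finite_moments (wJS alpha beta w0))
    (t gamma A B : R) (ht : 0 <= t <= 1) (hgamma : 0 < gamma)
    (wt := weight alpha beta w0 t gamma A B)
    (v := vJS alpha beta w0)
    (hw_ge0 : forall x : R, 0 < x < 1 -> 0 <= wt x)
    (hw_pos : (0 < lebesgue_measure [set x | (0 < x < 1)%R /\ (0 < wt x)%R])%E)
    (P : nat -> {poly R}) (h : nat -> R) (hP : monic_OPs wt P h)
    (n : nat) (z dvz : R[i]) (hz0 : z <> 0) (hz1 : z <> 1)
    (hdvz : is_dv v z dvz)
    (An := A_coef v wt t gamma P h z dvz)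
    (Bn := B_coef v wt t gamma P h z dvz) :
  (A_cvg v wt t P z dvz n -> B_cvg v wt t P z dvz n ->
     ceval (P n)^`() z
     = - Bn n * ceval (P n) z
       + (beta_rec h n)%:C * An n * ceval (shift1 P n) z)
  /\
  (B_cvg v wt t P z dvz n ->
   (if n is m.+1 then A_cvg v wt t P z dvz m else True) ->
     ceval (shift1 P n)^`() z
     = (Bn n + dvz) * ceval (shift1 P n) z - shift1 An n * ceval (P n) z).
Proof.
move/eqP: hz0 => hz0'; move/eqP: hz1 => hz1'.
have ceval0 : ceval 0 z = 0 by rewrite /ceval rmorph0 horner0.
case: n => [|m].
  (* For [n = 0] the conventions make [P_(-1)], [A_(-1)], [B_0] and [beta_0] zero, and [P_0] is
     constant, so both sides vanish. *)
  split=> [_ _|_ _]; rewrite /= ?deriv0 !ceval0 ?mulr0 ?mul0r ?subr0//.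
  have /size_poly1P[c _ ->] : size (P 0) == 1%N by have [->] := hP.1 0%N.
  by rewrite derivC ceval0 /Bn /= oppr0 mul0r addr0.
rewrite /ceval -!deriv_map; split=> [An_cvg Bn_cvg|Bn_cvg Am_cvg].
  exact: (lowering_relation halpha hbeta hw0 hmom hgamma hP).
exact: (raising_relation halpha hbeta hw0 hmom hgamma hP).
Qed.
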